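(* Let $p>1$, let $\Omega\subset\mathbb{R}^n$ be Lebesgue measurable, let $\mu$ be Lebesgue measure, let $(E,\|\cdot\|)$ be a nonzero Banach space, and let $u:\Omega\to\mathbb{R}$ be $\mu$-measurable. Then $$\left\|\int_\Omega f\,d\mu\right\|^p\le\int_\Omega u\,\|f\|^p\,d\mu\quad\text{for all } f\in L^1(\Omega\to E)$$ if and only if $$u>0\ \ \mu\text{-a.e. on }\Omega\quad\text{and}\quad\int_\Omega u^{\frac{1}{1-p}}\,d\mu\le 1.$$
   Context: $L^1(\Omega\to E)$ denotes the space of strongly (Bochner) measurable, Bochner integrable functions $f:\Omega\to E$; $\int_\Omega f\,d\mu$ is the Bochner integral. Saying the inequality holds for $f$ includes that $\int_\Omega u\|f\|^p\,d\mu$ is well defined as an extended real number in $[-\infty,\infty]$ (the value $+\infty$ is allowed). *)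

(* Defs.v *)
From HB Require Import structures.
From mathcomp Require Import all_boot all_order all_algebra.
From mathcomp Require Import all_classical all_reals all_analysis.
From mathcomp Require Import measurable_realfun.

Set Implicit Arguments.
Unset Strict Implicit.
Unset Printing Implicit Defensive.

Import Order.TTheory GRing.Theory Num.Theory.
Import numFieldNormedType.Exports.

Local Open Scope classical_set_scope.
Local Open Scope ring_scope.

Section lebesgue_outer.
Context (R : realType) (n : nat).

Definition box (ab : 'rV[R]_n * 'rV[R]_n) : set 'rV[R]_n :=
  [set x | forall i, ab.1 ord0 i < x ord0 i <= ab.2 ord0 i].

(* The [max] makes the volume of an empty box 0, also when several sides are
   reversed. *)
Definition box_volume (ab : 'rV[R]_n * 'rV[R]_n) : \bar R :=
  (\prod_(i < n) Num.max 0 (ab.2 ord0 i - ab.1 ord0 i))%:E.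

(* [D] may be finite or empty, so that the empty set has outer measure 0 also
   for n = 0, where the only box is the whole space, of volume 1. *)
Definition lebesgue_outer (A : set 'rV[R]_n) : \bar R :=
  ereal_inf [set \esum_(ab in D) box_volume ab |
    D in [set D | countable D /\ A `<=` \bigcup_(ab in D) box ab]].

Local Open Scope ereal_scope.

Lemma box_volume_ge0 ab : 0 <= box_volume ab.
Proof. by rewrite lee_fin; apply: prodr_ge0 => i _; rewrite le_max lexx. Qed.

Lemma lebesgue_outer_ge0 A : 0 <= lebesgue_outer A.
Proof.
apply: le_ereal_inf_tmp => _ [D _ <-].
by apply: esum_ge0 => ab _; exact: box_volume_ge0.
Qed.

Lemma lebesgue_outer0 : lebesgue_outer set0 = 0.
Proof.
apply/eqP; rewrite eq_le lebesgue_outer_ge0 andbT.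
apply: ereal_inf_lbound; exists set0; last exact: esum_set0.
by split => //; exact: countable0.
Qed.

Lemma le_lebesgue_outer : {homo lebesgue_outer : A B / A `<=` B >-> A <= B}.
Proof.
move=> A B AB; apply/ereal_inf_le_tmp => _ [D [cD BD] <-].
by exists D => //; split => //; exact: subset_trans BD.
Qed.

Lemma lebesgue_outer_sigma_subadditive : sigma_subadditive lebesgue_outer.
Proof.
move=> A; have [[i ioo]|] := pselect (exists i, lebesgue_outer (A i) = +oo).
  rewrite (eseries_pinfty _ _ ioo) ?leey// => k _.
  by rewrite -ltNye (lt_le_trans _ (lebesgue_outer_ge0 _)).
rewrite -forallNE => Aoo; apply/lee_addgt0Pr => e e0.
have covers i : exists D, [/\ countable D, A i `<=` \bigcup_(ab in D) box ab
    & \esum_(ab in D) box_volume ab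
      <= lebesgue_outer (A i) + (e / (2 ^ i.+1)%:R)%:E].
  have fA : lebesgue_outer (A i) \is a fin_num.
    by rewrite ge0_fin_numE ?lebesgue_outer_ge0// ltey; exact/eqP/Aoo.
  have e0i : (0 < e / (2 ^ i.+1)%:R)%R by rewrite divr_gt0// ltr0n expn_gt0.
  have [_ [D [cD AD] <-] Dlt] := lb_ereal_inf_adherent e0i fA.
  by exists D; split => //; exact: ltW.
have [D Dp] := choice covers.
apply: (@le_trans _ _
    (\sum_(i <oo) (lebesgue_outer (A i) + (e / (2 ^ i.+1)%:R)%:E))); last first.
  by apply: epsilon_trick; [move=> i; exact: lebesgue_outer_ge0|exact: ltW].
apply: (@le_trans _ _ (\sum_(i <oo) \esum_(ab in D i) box_volume ab)); last first.
  apply: lee_nneseries => [i _ _|i _]; last by have [] := Dp i.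
  by apply: esum_ge0 => ab _; exact: box_volume_ge0.
apply: (@le_trans _ _ (\esum_(ab in \bigcup_i D i) box_volume ab)).
  apply: ereal_inf_lbound; exists (\bigcup_i D i) => //; split.
    by apply: bigcup_countable => // i _; have [] := Dp i.
  move=> x [i _ Aix]; have [_ /(_ _ Aix)[ab Dab xab] _] := Dp i.
  by exists ab => //; exists i.
rewrite seqDU_bigcup_eq nneseries_sum_bigcup; last 2 first.
  exact: trivIset_seqDU.
  by move=> ab; exact: box_volume_ge0.
apply: lee_nneseries => [i _ _|i _].
  by apply: esum_ge0 => ab _; exact: box_volume_ge0.
apply: ereal_sup_le => _ [F [fF FD] <-]; exists F => //; split => //.
by apply: subset_trans FD _; exact: subset_seqDU.
Qed.

HB.instance Definition _ := isOuterMeasure.Build R 'rV[R]_n lebesgue_outer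
  lebesgue_outer0 lebesgue_outer_ge0 le_lebesgue_outer
  lebesgue_outer_sigma_subadditive.

End lebesgue_outer.

(* R^n with the sigma-algebra of Lebesgue (i.e. Caratheodory) measurable sets *)
Notation Rn R n := (caratheodory_type (@lebesgue_outer R n)).

Definition lebesgue_Rn (R : realType) (n : nat) :
    {measure set (Rn R n) -> \bar R} :=
  let mu : {outer_measure set 'rV[R]_n -> \bar R} := @lebesgue_outer R n in
  (mu : set (caratheodory_type mu) -> \bar R).

(* Functions on [D] are represented by functions on the whole type [T], whose
   values outside [D] are irrelevant. *)
Section bochner.
Context d (T : measurableType d) (R : realType) (E : normedModType R).
Variables (mu : {measure set T -> \bar R}) (D : set T).
Implicit Types (f : T -> E).

Definition simple_on (s : T -> E) :=
  [/\ finite_set (s @` D),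
      forall y, measurable (D `&` s @^-1` [set y]) &
      forall y, y != 0 -> (mu (D `&` s @^-1` [set y]) < +oo)%E].

(* The value y = 0 contributes 0 even if its fibre has infinite measure. *)
Definition simple_integral (s : T -> E) : E :=
  \sum_(y \in s @` D) fine (mu (D `&` s @^-1` [set y])) *: y.

(* Limit almost everywhere, so [mu] is meant to be complete, as [lebesgue_Rn]
   is. *)
Definition strongly_measurable f :=
  exists s : nat -> T -> E, (forall k, simple_on (s k)) /\
    {ae mu, forall x, D x -> s k x @[k --> \oo] --> f x}.

Definition L1_approximation (s : nat -> T -> E) f :=
  (forall k, simple_on (s k)) /\
  (\int[mu]_(x in D) (`|f x - s k x|)%:E)%E @[k --> \oo] --> 0%E.

Definition bochner_integrable f :=
  strongly_measurable f /\ exists s, L1_approximation s f.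

(* The limit of the integrals of an L1-approximation of [f] exists if E is
   complete and does not depend on the approximation; [xget] selects it. *)
Definition bochner_integral f : E :=
  xget 0 [set I | exists s, L1_approximation s f /\
                    simple_integral (s k) @[k --> \oo] --> I].

End bochner.

(* The Lebesgue integral of [g] over [D] makes sense in [-oo, +oo]: the integrals
   of its positive and negative parts are not both +oo. (The library sets
   +oo - oo = -oo, so that its integral is otherwise always defined.) *)
Definition integral_well_defined d (T : measurableType d) (R : realType)
    (mu : {measure set T -> \bar R}) (D : set T) (g : T -> \bar R) :=
  measurable_fun D g /\
  ((\int[mu]_(x in D) g^\+ x) +? - (\int[mu]_(x in D) g^\- x))%E.

(* Main.v *)
(* Sufficiency.  Young's inequality with the constant c = |int f| gives, where
   u > 0,
     p c^(p-1) |f| <= u |f|^p + (p - 1) c^p u^(1/(1-p)).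
   Integrating, with c <= int |f| and int u^(1/(1-p)) <= 1, yields
   p c^p <= int u |f|^p + (p - 1) c^p.

   Necessity.  Fix a unit vector e.  Testing on f = 1_B e with B of finite measure
   inside {u <= 0} gives mu(B)^p <= 0; sigma-finiteness then gives u > 0 a.e.
   Testing on f = h e with h <= v := u^(1/(1-p)) simple and of finite integral c,
   one has u h^p <= h u v^(p-1) = h, hence c^p <= c and c <= 1; take the supremum
   over h. *)
Require Import Defs.
From mathcomp Require Import all_boot all_order all_algebra.
From mathcomp Require Import all_classical all_reals all_analysis.
From mathcomp Require Import measurable_realfun.
From mathcomp Require Import ring lra.
Set Implicit Arguments.
Unset Strict Implicit.
Unset Printing Implicit Defensive.
Import Order.TTheory GRing.Theory Num.Theory.
Import numFieldNormedType.Exports.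
Local Open Scope classical_set_scope.
Local Open Scope ring_scope.


(** * Lebesgue measure on R^n *)

(** Choosing one preimage [g y] for each image point turns the left side into a sum over a subset of
    [P]. Injectivity of [e] cannot be assumed, since cutting distinct boxes by a hyperplane may give
    the same box. *)
Lemma le_esum_image (R : realType) (T T' : choiceType) (P : set T) (e : T -> T')
    (a : T' -> \bar R) : (forall y, 0 <= a y)%E ->
  (\esum_(j in e @` P) a j <= \esum_(i in P) a (e i))%E.
Proof.
move=> a0; have [->|/set0P[x0 Px0]] := eqVneq P set0.
  by rewrite image_set0 !esum_set0.
pose g y := xget x0 [set x | P x /\ e x = y].
have gP y : (e @` P) y -> P (g y) /\ e (g y) = y.
  by move=> [x Px exy]; apply: (@xgetPex _ x0 [set x | P x /\ e x = y]); exists x.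
have eg : e @` P = e @` (g @` (e @` P)).
  apply/seteqP; split=> [y Py|_ [_ [y Py <-] <-]]; last by rewrite (gP _ Py).2.
  by exists (g y); [exists y|exact: (gP _ Py).2].
rewrite eg esum_image; last first.
  move=> _ _ /set_mem[y Py <-] /set_mem[z Pz <-].
  by rewrite (gP _ Py).2 (gP _ Pz).2 => ->.
rewrite esum_mkcond [leRHS]esum_mkcond; apply: le_esum => x _.
case: ifPn => [/set_mem[y Py <-]|_]; first by rewrite mem_set//; exact: (gP _ Py).1.
by case: ifP.
Qed.

Section lebesgue_boxes.
Context (R : realType) (n : nat).
Implicit Types (ab : 'rV[R]_n * 'rV[R]_n) (i : 'I_n) (c : R).

(** If the hyperplane where the [i]-th coordinate is [c] misses a nonempty box, one of the two
    pieces has a reversed or degenerate side, so it is empty and has volume 0. *)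
Definition box_below i c ab : 'rV[R]_n * 'rV[R]_n :=
  (ab.1, \row_j if j == i then Num.min (ab.2 ord0 j) c else ab.2 ord0 j).

Definition box_above i c ab : 'rV[R]_n * 'rV[R]_n :=
  (\row_j (if j == i then Num.max (ab.1 ord0 j) c else ab.1 ord0 j), ab.2).

Lemma box_belowE i c ab :
  box (box_below i c ab) = box ab `&` [set x | x ord0 i <= c].
Proof.
apply/seteqP; split=> [x xb|x [xb xc] j]; last first.
  rewrite /= !mxE; case: eqP => [->|_]; last exact: xb.
  by rewrite le_min xc andbT; exact: xb.
split=> [j|/=].
  by have := xb j; rewrite /= !mxE; case: eqP => // ->; rewrite le_min;
     move=> /andP[-> /andP[->]].
by have := xb i; rewrite /= !mxE eqxx le_min => /andP[_ /andP[]].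
Qed.

Lemma box_aboveE i c ab :
  box (box_above i c ab) = box ab `&` ~` [set x | x ord0 i <= c].
Proof.
apply/seteqP; split=> [x xb|x [xb /negP]].
  split=> [j|/=].
    by have := xb j; rewrite /= !mxE; case: eqP => // ->; rewrite gt_max;
       move=> /andP[/andP[-> _] ->].
  by have := xb i; rewrite /= !mxE eqxx gt_max => /andP[/andP[_ +] _];
     rewrite ltNge => /negP.
rewrite -ltNge => xc j; rewrite /= !mxE; case: eqP => [->|_]; last exact: xb.
by rewrite gt_max xc andbT; exact: xb.
Qed.

(** Only the [i]-th factor differs among the three products, which leaves a case analysis on the
    order of [c] and the two endpoints. *)
Lemma box_volume_split i c ab :
  (box_volume (box_below i c ab) + box_volume (box_above i c ab)
   = box_volume ab)%E.
Proof.
rewrite /box_volume -EFinD; congr (_%:E).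
rewrite (bigD1 i)//= [X in _ + X](bigD1 i)//= [RHS](bigD1 i)//= !mxE eqxx.
under eq_bigr => j /negPf ji do rewrite !mxE ji.
under [X in _ + _ * X]eq_bigr => j /negPf ji do rewrite !mxE ji.
rewrite -mulrDl; congr (_ * _).
rewrite !maxElt !minElt; repeat case: ifPn; rewrite -?leNgt; lra.
Qed.

Lemma lebesgue_outer_box ab : (lebesgue_outer (box ab) <= box_volume ab)%E.
Proof.
apply: ereal_inf_lbound; exists [set ab]; last exact/esum_set1/box_volume_ge0.
by split=> [|x abx]; [exact: countable1|exists ab].
Qed.

(** By subadditivity only one inequality of the Caratheodory criterion is at stake. Cutting each box
    of a cover of [X] along the hyperplane covers both parts of [X] with the same total volume. *)
Lemma halfspace_measurable i c :
  measurable ([set x | x ord0 i <= c] : set (Rn R n)).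
Proof.
apply: le_caratheodory_measurable => X /=; apply: le_ereal_inf_tmp => _ [D [cD XD] <-].
have -> : (\esum_(ab in D) box_volume ab = \esum_(ab in D) box_volume (box_below i c ab) +
    \esum_(ab in D) box_volume (box_above i c ab))%E.
  rewrite -esumD; [|by move=> *; exact: box_volume_ge0..].
  by apply: eq_esum => ab _; rewrite box_volume_split.
apply: leeD.
- apply: le_trans (@le_esum_image _ _ _ D (box_below i c) _ (@box_volume_ge0 R n)).
  apply: ereal_inf_lbound; exists (box_below i c @` D) => //; split.
    exact: sub_countable (card_image_le _ _) cD.
  move=> x [/XD[ab Dab abx] xc]; exists (box_below i c ab); first by exists ab.
  by rewrite box_belowE.
- apply: le_trans (@le_esum_image _ _ _ D (box_above i c) _ (@box_volume_ge0 R n)).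
  apply: ereal_inf_lbound; exists (box_above i c @` D) => //; split.
    exact: sub_countable (card_image_le _ _) cD.
  move=> x [/XD[ab Dab abx] xc]; exists (box_above i c ab); first by exists ab.
  by rewrite box_aboveE.
Qed.

Lemma box_measurable ab : measurable (box ab : set (Rn R n)).
Proof.
have -> : box ab = \bigcap_(i in [set: 'I_n])
    (~` [set x | x ord0 i <= ab.1 ord0 i] `&` [set x | x ord0 i <= ab.2 ord0 i]).
  apply/seteqP; split=> x xb i; have := xb i => //=.
    by move=> /andP[lo hi] _; split=> //; apply/negP; rewrite -ltNge.
  by move=> /(_ I)[/negP]; rewrite -ltNge => -> ->.
apply: fin_bigcap_measurable => // i _.
by apply: measurableI; [apply: measurableC|]; exact: halfspace_measurable.
Qed.

Lemma lebesgue_Rn_sigma_finite : sigma_finite setT (lebesgue_Rn R n).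
Proof.
exists (fun k => box (const_mx (- k%:R), const_mx k%:R)); last first.
  move=> k; split; first exact: box_measurable.
  exact: le_lt_trans (lebesgue_outer_box _) (ltry _).
apply/esym; rewrite -subTset => x _.
have [M Mx] : exists M : R, forall i, `|x ord0 i| < M.
  exists (1 + \sum_i `|x ord0 i|) => i.
  rewrite (bigD1 i)//= addrCA ltrDl ltr_wpDr//.
  by apply: sumr_ge0.
exists (Num.truncn M).+1 => // i /=; rewrite !mxE.
have := Mx i; rewrite ltr_norml => /andP[lo hi].
by have := truncnS_gt M => h; apply/andP; split; lra.
Qed.

Lemma lebesgue_Rn_complete : measure_is_complete (lebesgue_Rn R n).
Proof. exact: measure_is_complete_caratheodory. Qed.

End lebesgue_boxes.

(** * Simple functions and the Bochner integral *)

Section simple_functions.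
Context d (T : measurableType d) (R : realType) (mu : {measure set T -> \bar R}).
Variables (D : set T) (mD : measurable D).

(** * Functions that factor through a finitely valued map *)

Section composition.
Context (W : choiceType) (h : T -> W).
Hypothesis finh : finite_set (h @` D).
Hypothesis mh : forall w, measurable (D `&` h @^-1` [set w]).

Let fiber w := D `&` h @^-1` [set w].

Lemma fiber_comp (V : Type) (phi : W -> V) (Y : set V) :
  D `&` (phi \o h) @^-1` Y =
  \bigcup_(w in h @` D `&` phi @^-1` Y) fiber w.
Proof.
apply/seteqP; split=> [x [Dx Yx]|x [w [_ Yw] [Dx hx]]].
  by exists (h x) => //; split => //; exists x.
by split => //=; rewrite [h x]hx.
Qed.

Let finite_fibers (V : Type) (phi : W -> V) (Y : set V) :
  finite_set (h @` D `&` phi @^-1` Y).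
Proof. exact: sub_finite_set finh. Qed.

Let mfiber w : measurable (fiber w).
Proof. exact: mh. Qed.

Let trivIset_fiber (S : set W) : trivIset S fiber.
Proof. by move=> v w _ _ [x [[_ hv] [_ hw]]]; rewrite -hv; exact: hw. Qed.

Lemma measure_fiber_comp (V : Type) (phi : W -> V) (Y : set V) :
  (mu (D `&` (phi \o h) @^-1` Y) =
   \sum_(w \in h @` D `&` phi @^-1` Y) mu (fiber w))%E.
Proof. by rewrite fiber_comp measure_fin_bigcup//. Qed.

Lemma measurable_fun_fin_comp d' (V : measurableType d') (phi : W -> V) :
  measurable_fun D (phi \o h).
Proof. by move=> _ Y mY; rewrite fiber_comp; exact: fin_bigcup_measurable. Qed.

Section vector_valued_comp.
Context (E : normedModType R) (phi : W -> E).
Hypothesis fin_fiber : forall w, phi w != 0 -> (mu (fiber w) < +oo)%E.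

Lemma simple_on_comp : simple_on mu D (phi \o h).
Proof.
split=> [|y|y y0].
- by rewrite -image_comp; exact: finite_image.
- by rewrite fiber_comp; exact: fin_bigcup_measurable.
- rewrite measure_fiber_comp fsbig_finite//= big_seq; apply/lte_sum_pinfty => w.
  rewrite in_fset_set// => /set_mem[_ /= phiw].
  by apply: fin_fiber; rewrite phiw.
Qed.

Lemma simple_integral_comp :
  simple_integral mu D (phi \o h) =
  \sum_(w \in h @` D) fine (mu (fiber w)) *: phi w.
Proof.
have finY : finite_set ((phi \o h) @` D) by have [] := simple_on_comp.
rewrite /simple_integral.
(* The values [w] of [h] are grouped by [y = phi w]; exchanging the two finite sums then leaves a
   single [y] for each [w]. *)
transitivity (\sum_(y \in (phi \o h) @` D) \sum_(w \in h @` D)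
    (if phi w == y then fine (mu (fiber w)) *: phi w else 0)).
  (* The value 0 is treated apart: its fibres may have infinite measure, where [fine] is not
     additive, but every term is scaled by 0. *)
  apply: eq_fsbigr => y _; have [->|y0] := eqVneq y 0.
    rewrite scaler0 fsbig1// => w _.
    by case: eqP => // ->; rewrite scaler0.
  rewrite measure_fiber_comp fsbig_finite//= big_seq.
  rewrite -sum_fine => [|w]; last first.
    rewrite in_fset_set// => /set_mem[_ /= phiw].
    by rewrite ge0_fin_numE//; apply: fin_fiber; rewrite phiw.
  rewrite -big_seq scaler_suml -fsbig_finite//= fsbig_mkcondr.
  apply: eq_fsbigr => w _; rewrite /preimage/=.
  case: ifPn => [/set_mem/= ->|]; first by rewrite eqxx.
  by rewrite notin_setE/= => /eqP/negPf ->.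
rewrite exchange_fsbig//; apply: eq_fsbigr => w /set_mem[x Dx <-].
rewrite (fsbigD1 (phi (h x)))//=; last by exists x.
rewrite eqxx fsbig1 ?addr0// => y [_ /= /eqP yphi].
by rewrite eq_sym (negPf yphi).
Qed.

End vector_valued_comp.

(** The integrand is a finite sum of weighted indicators of fibres. A fibre of infinite measure has
    weight 0, so [fine] loses nothing. *)
Lemma integral_fin_comp (psi : W -> R) :
  (forall w, 0 <= psi w) -> (forall w, psi w != 0 -> (mu (fiber w) < +oo)%E) ->
  (\int[mu]_(x in D) (psi (h x))%:E =
   (\sum_(w \in h @` D) fine (mu (fiber w)) * psi w)%:E)%E.
Proof.
move=> psi0 fin_fiber.
transitivity (\int[mu]_(x in D)
    (\sum_(w \in h @` D) (psi w * \1_(fiber w) x)%:E))%E.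
  apply: eq_integral => x /set_mem Dx.
  rewrite (fsbigD1 (h x))//=; last by exists x.
  rewrite indicE mem_set// mulr1 fsbig1 ?adde0// => w [_ /= wh].
  by rewrite indicE memNset ?mulr0// => -[_ /= /esym].
rewrite ge0_integral_fsum//; first last.
- by move=> w x _; rewrite lee_fin mulr_ge0.
- by move=> w; apply/measurable_EFinP; exact: measurable_funM.
rewrite -fsumEFin//; apply: eq_fsbigr => w _.
rewrite (@integralZl_indic _ _ _ _ _ mD (fun=> fiber w))//; last first.
  by move=> /lt_geF; rewrite psi0.
rewrite integral_indic// setIAC setIid.
have [->|w0] := eqVneq (psi w) 0; first by rewrite mul0e mulr0.
by rewrite muleC EFinM fineK// ge0_fin_numE//; exact: fin_fiber.
Qed.

End composition.

Section vector_valued.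
Context (E : normedModType R).
Implicit Types s t : T -> E.

Lemma measurable_norm_simple s : simple_on mu D s ->
  measurable_fun D (fun x => `|s x|).
Proof. by move=> [fins ms _]; exact: (@measurable_fun_fin_comp _ s). Qed.

Lemma norm_simple_integral_le s : simple_on mu D s ->
  ((`|simple_integral mu D s|)%:E <= \int[mu]_(x in D) (`|s x|)%:E)%E.
Proof.
move=> [fins ms mus].
rewrite (@integral_fin_comp _ s _ _ (fun y => `|y|))//; last first.
  by move=> w; rewrite normr_eq0; exact: mus.
rewrite lee_fin /simple_integral !fsbig_finite//=.
apply: le_trans (ler_norm_sum _ _ _) _; apply: ler_sum => y _.
by rewrite normrZ ger0_norm// fine_ge0.
Qed.

Section pair.
Variables (s t : T -> E).
Hypotheses (ss : simple_on mu D s) (st : simple_on mu D t).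

(** The fibres of the pair form the common refinement of the partitions given by [s] and [t]; both
    integrals and that of the difference are computed over it. *)
Let h x := (s x, t x).

Let finh : finite_set (h @` D).
Proof.
have [fins _ _] := ss; have [fint _ _] := st.
apply: sub_finite_set (finite_setX fins fint) => _ [x Dx <-].
by split; exists x.
Qed.

Let fiber_pair w : D `&` h @^-1` [set w] =
  (D `&` s @^-1` [set w.1]) `&` (D `&` t @^-1` [set w.2]).
Proof.
by apply/seteqP; split=> [x [Dx <-]//|x [[Dx /= sx] [_ /= tx]]]; split => //;
  rewrite /h /= sx tx -surjective_pairing.
Qed.

Let mh w : measurable (D `&` h @^-1` [set w]).
Proof.
have [_ ms _] := ss; have [_ mt _] := st.
by rewrite fiber_pair; exact: measurableI.
Qed.

Let fin1 w : w.1 != 0 -> (mu (D `&` h @^-1` [set w]) < +oo)%E.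
Proof.
have [_ ms mus] := ss => /mus; apply: le_lt_trans.
by rewrite le_measure ?inE// fiber_pair; exact: subIsetl.
Qed.

Let fin2 w : w.2 != 0 -> (mu (D `&` h @^-1` [set w]) < +oo)%E.
Proof.
have [_ mt mut] := st => /mut; apply: le_lt_trans.
by rewrite le_measure ?inE// fiber_pair; exact: subIsetr.
Qed.

Let fin12 w : w.1 - w.2 != 0 -> (mu (D `&` h @^-1` [set w]) < +oo)%E.
Proof.
have [w1|/fin1//] := eqVneq w.1 0.
by rewrite w1 sub0r oppr_eq0; exact: fin2.
Qed.

Lemma simple_onB : simple_on mu D (fun x => s x - t x).
Proof. exact: (@simple_on_comp _ h finh mh _ (fun w => w.1 - w.2)). Qed.

Lemma simple_integralB : simple_integral mu D (fun x => s x - t x) =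
  simple_integral mu D s - simple_integral mu D t.
Proof.
have := @simple_integral_comp _ h finh mh _ _ fin12 => /= ->.
have := @simple_integral_comp _ h finh mh _ _ fin1 => /= ->.
have := @simple_integral_comp _ h finh mh _ _ fin2 => /= ->.
rewrite !fsbig_finite//= -sumrB; apply: eq_bigr => w _.
by rewrite scalerBr.
Qed.

End pair.
End vector_valued.
End simple_functions.

(** * The Bochner integral of simple functions and its norm bound *)

Section bochner_theory.
Context d (T : measurableType d) (R : realType) (mu : {measure set T -> \bar R}).
Variables (D : set T) (mD : measurable D).
Context (E : normedModType R).
Implicit Types f s t : T -> E.

Lemma simple_on_strongly_measurable s :
  simple_on mu D s -> strongly_measurable mu D s.
Proof. by move=> ss; exists (fun=> s); split => //; apply: aeW => x _; exact: cvg_cst. Qed.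

Lemma simple_on_L1_approximation s :
  simple_on mu D s -> L1_approximation mu D (fun=> s) s.
Proof.
move=> ss; split => //; under eq_fun do under eq_integral do rewrite subrr normr0.
under eq_fun do rewrite integral0.
exact: cvg_cst.
Qed.

(** The constant sequence is one admissible approximation. For any other one [t], the integrals of
    [s] and [t k] differ in norm by at most the integral of [|s - t k|], which tends to 0, so [xget]
    has a unique candidate. *)
Lemma bochner_integral_simple s :
  simple_on mu D s -> bochner_integral mu D s = simple_integral mu D s.
Proof.
move=> ss; apply: xget_unique => [|I [t [[st tcvg] tI]]].
  exists (fun=> s); split; first exact: simple_on_L1_approximation.
  exact: cvg_cst.
apply: (cvg_unique (@norm_hausdorff _ _) tI).
suff : simple_integral mu D s - simple_integral mu D (t k) @[k --> \oo] --> (0 : E).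
  move=> /(cvgB (cvg_cst (simple_integral mu D s))); rewrite subr0.
  rewrite (_ : (_ - _) = simple_integral mu D \o t)//.
  by apply/funext => k; rewrite /= fctE subKr.
apply: norm_cvg0.
have : (`|simple_integral mu D s - simple_integral mu D (t k)|%:E @[k --> \oo] --> 0)%E.
  apply: squeeze_cvge (cvg_cst _) tcvg.
  apply: nearW => k; rewrite lee_fin normr_ge0/= -simple_integralB//.
  by apply: norm_simple_integral_le => //; exact: simple_onB.
by move=> /fine_cvg.
Qed.

Hypothesis cmu : measure_is_complete mu.

(** Multiplying by the indicator of the complement of the null set [N] makes the norms of the
    approximants converge everywhere on [D]. Their measurable limit [g] agrees with [|f|] almost
    everywhere on [D], and completeness of [mu] transfers measurability. *)
Lemma strongly_measurable_norm f : strongly_measurable mu D f ->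
  measurable_fun D (fun x => `|f x|).
Proof.
move=> [s [ss [N [mN N0 sN]]]].
pose g x := `|f x| * \1_(~` N) x.
have mg : measurable_fun D g.
  apply: (@measurable_fun_cvg _ _ _ _ (fun k x => `|s k x| * \1_(~` N) x)) => [k|x Dx].
    apply: measurable_funM; first exact: measurable_norm_simple.
    by apply: measurable_indic; exact: measurableC.
  rewrite /g indicE; have [Nx|Nx] := pselect (N x).
    rewrite memNset//.
    by rewrite mulr0; under eq_fun do rewrite mulr0; exact: cvg_cst.
  apply: cvgMr_tmp; apply: cvg_norm.
  by apply: contrapT => sfx; apply/Nx/sN => sf; exact/sfx/sf.
apply/measurable_EFinP; apply: (@ae_measurable_fun _ _ _ mu cmu _ (EFin \o g)).
  exists N; split => // x /= gf; apply: contrapT => Nx; apply: gf => Dx.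
  by rewrite /g indicE mem_set// mulr1.
exact/measurable_EFinP.
Qed.

Lemma strongly_measurableB f t : strongly_measurable mu D f -> simple_on mu D t ->
  strongly_measurable mu D (fun x => f x - t x).
Proof.
move=> [s [ss sf]] st; exists (fun k x => s k x - t x); split.
  by move=> k; exact: simple_onB.
by apply: filterS sf => x sfx /sfx; move=> h; apply: cvgB => //; exact: cvg_cst.
Qed.

(** The integral of [s k] has norm at most the integral of [|s k|], hence at most that of [|f|] plus
    that of [|f - s k|]; then [k] tends to infinity. *)
Lemma norm_bochner_integral_le f : strongly_measurable mu D f ->
  ((`|bochner_integral mu D f|)%:E <= \int[mu]_(x in D) (`|f x|)%:E)%E.
Proof.
(* If no limit exists, [xget] returns its default 0, whose norm satisfies the bound trivially. *)
move=> mf; rewrite /bochner_integral; case: xgetP => [I _ [s [[ss scvg] sI]]|_]; last first.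
  by rewrite normr0; exact: integral_ge0.
have mnf : measurable_fun D (fun x => (`|f x|)%:E).
  by apply/measurable_EFinP; exact: strongly_measurable_norm.
have mnfs k : measurable_fun D (fun x => (`|f x - s k x|)%:E).
  by apply/measurable_EFinP/strongly_measurable_norm/strongly_measurableB.
apply: (@lee_cvg_to _ \oo _ _ (fun k => (`|simple_integral mu D (s k)|)%:E)
  (fun k => \int[mu]_(x in D) (`|f x|)%:E + \int[mu]_(x in D) (`|f x - s k x|)%:E)%E).
- apply: cvg_EFin; first exact: nearW.
  exact: cvg_norm.
- rewrite -[X in _ --> X]adde0; apply: cvgeD => //; last exact: cvg_cst.
  by rewrite fin_num_adde_defl.
apply: nearW => k; rewrite -ge0_integralD//.
apply: le_trans (norm_simple_integral_le mD (ss k)) _.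
apply: ge0_le_integral => //.
- by apply/measurable_EFinP; exact: measurable_norm_simple.
- exact: emeasurable_funD.
- move=> x _; rewrite -EFinD lee_fin -{1}(subKr (f x) (s k x)).
  exact: ler_normB.
Qed.

End bochner_theory.

(** Here [g] may change sign and need not be integrable: dropping its negative part can only
    increase the integral, and the positive part still lies below [h]. *)
Lemma le_integral_ge0 d (T : measurableType d) (R : realType)
    (mu : {measure set T -> \bar R}) (D : set T) (g h : T -> \bar R) :
  measurable D -> measurable_fun D g -> measurable_fun D h ->
  (forall x, D x -> 0 <= h x)%E -> (forall x, D x -> g x <= h x)%E ->
  (\int[mu]_(x in D) g x <= \int[mu]_(x in D) h x)%E.
Proof.
move=> mD mg mh h0 gh; rewrite integralE.
apply: (@le_trans _ _ (\int[mu]_(x in D) g^\+ x - 0)%E).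
  by apply: leeB => //; exact: integral_ge0.
rewrite sube0; apply: ge0_le_integral => //; first exact: measurable_funepos.
by move=> x Dx; rewrite funeposE ge_max gh// h0.
Qed.

(** * The weighted inequality *)

(** Young's inequality for the factors [a u^(1/p)] and [c^(p-1) u^(-1/p)], with conjugate exponents
    [p] and [q = p/(p-1)], multiplied by [p]. *)
Lemma young_powR (R : realType) (p a c u : R) : 1 < p -> 0 <= a -> 0 <= c -> 0 < u ->
  p * c `^ (p - 1) * a <= u * a `^ p + (p - 1) * c `^ p * u `^ (1 / (1 - p)).
Proof.
move=> p1 a0 c0 u0.
have p0 : 0 < p by lra.
have pm0 : 0 < p - 1 by lra.
have p0' : p != 0 by rewrite gt_eqF.
have pm0' : p - 1 != 0 by rewrite gt_eqF.
have mp0' : 1 - p != 0 by rewrite lt_eqF//; lra.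
pose q := p / (p - 1).
have q0 : 0 < q by rewrite divr_gt0.
have pq : p^-1 + q^-1 = 1 by rewrite /q; field; rewrite ?p0' ?pm0' ?mp0'.
have := @conjugate_powR _ (a * u `^ p^-1) (c `^ (p - 1) * u `^ (- p^-1)) p q.
rewrite !mulr_ge0 ?powR_ge0// => /(_ isT isT p0 q0 pq).
rewrite !powRM ?powR_ge0// -!powRrM mulVf ?gt_eqF// powRr1 ?(ltW u0)//.
have -> : (p - 1) * q = p by rewrite /q; field; rewrite ?p0' ?pm0' ?mp0'.
have -> : - p^-1 * q = 1 / (1 - p).
  by rewrite /q; field; rewrite ?p0' ?pm0' ?mp0'.
have -> : a * u `^ p^-1 * (c `^ (p - 1) * u `^ (- p^-1)) = c `^ (p - 1) * a.
  by rewrite powRN; field; rewrite gt_eqF// powR_gt0.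
rewrite -(ler_pM2l p0) mulrA => /le_trans; apply; rewrite mulrDr.
rewrite le_eqVlt; apply/orP; left; apply/eqP.
by rewrite /q; field; rewrite ?p0' ?pm0' ?mp0'.
Qed.

(** For [u > 0], write [u h^p = h (u h^(p-1))] and bound the bracket by 1 using [h^(p-1) <= u^(-1)].
    For [u <= 0] the left side is nonpositive, whatever [powR] returns on such a base. *)
Lemma powR_dual_le (R : realType) (p h u : R) : 1 < p -> 0 <= h ->
  h <= u `^ (1 / (1 - p)) -> u * h `^ p <= h.
Proof.
move=> p1 h0 hu; have [u0|u0] := leP u 0.
  by apply: le_trans h0; rewrite mulr_le0_ge0// powR_ge0.
have pm0 : 0 < p - 1 by lra.
rewrite -mulr_powRB1//; last by lra.
rewrite mulrCA ler_piMr// mulrC -ler_pdivlMr// mul1r.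
apply: le_trans (ge0_ler_powR (ltW pm0) _ _ hu) _; rewrite ?nnegrE ?powR_ge0//.
rewrite -powRrM (_ : 1 / (1 - p) * (p - 1) = -1) ?(powR_inv1 (ltW u0))//.
by field; rewrite lt_eqF//; lra.
Qed.

(** * Test functions along one unit vector *)

Section scalar_times_unit_vector.
Context d (T : measurableType d) (R : realType) (mu : {measure set T -> \bar R}).
Variables (D : set T) (mD : measurable D).
Context (E : normedModType R) (e : E).
Hypothesis e1 : `|e| = 1.
Variable h : T -> R.
Hypotheses (h0 : forall x, 0 <= h x) (finh : finite_set (h @` D))
  (mh : forall r, measurable (D `&` h @^-1` [set r]))
  (muh : forall r, r != 0 -> (mu (D `&` h @^-1` [set r]) < +oo)%E).

Let muhe r : r *: e != 0 -> (mu (D `&` h @^-1` [set r]) < +oo)%E.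
Proof. by rewrite scaler_eq0 negb_or => /andP[/muh]. Qed.

Let simple_onZ : simple_on mu D (fun x => h x *: e).
Proof. exact: (@simple_on_comp _ _ _ _ _ _ h finh mh _ ( *:%R^~ e) muhe). Qed.

Lemma bochner_integrableZ : bochner_integrable mu D (fun x => h x *: e).
Proof.
split; first exact: simple_on_strongly_measurable.
by exists (fun=> fun x => h x *: e); exact: simple_on_L1_approximation.
Qed.

(** All values are nonnegative multiples of the same unit vector, so the triangle inequality becomes
    an equality. *)
Lemma norm_bochner_integralZ :
  (`|bochner_integral mu D (fun x => h x *: e)|%:E = \int[mu]_(x in D) (h x)%:E)%E.
Proof.
rewrite bochner_integral_simple//.
rewrite [simple_integral _ _ _](@simple_integral_comp _ _ _ _ _ _ h finh mh _ ( *:%R^~ e) muhe).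
(* [h] is nonnegative, but [integral_fin_comp] wants [psi] nonnegative on all
   of [R]: take the positive part. *)
pose hn (r : R) := Num.max 0 r.
transitivity (\int[mu]_(x in D) (hn (h x))%:E)%E; last first.
  by apply: eq_integral => x _; rewrite /hn max_r.
rewrite (@integral_fin_comp _ _ _ _ _ mD _ h finh mh hn); first last.
- by move=> r; rewrite /hn => r0; apply: muh; apply: contraNN r0 => /eqP ->; rewrite maxxx.
- by move=> r; rewrite le_max lexx.
congr (_%:E); rewrite !fsbig_finite//=.
under eq_bigr do rewrite scalerA.
rewrite -scaler_suml normrZ e1 mulr1 ger0_norm; last first.
  rewrite big_seq; apply: sumr_ge0 => r; rewrite in_fset_set// => /set_mem[x _ <-].
  by rewrite mulr_ge0// fine_ge0.
rewrite big_seq [RHS]big_seq; apply: eq_bigr => r.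
by rewrite in_fset_set// => /set_mem[x _ <-]; rewrite /hn max_r.
Qed.

End scalar_times_unit_vector.

Section weighted_inequality.
Context d (T : measurableType d) (R : realType) (mu : {measure set T -> \bar R}).
Variables (D : set T) (mD : measurable D).
Context (E : normedModType R) (p : R) (u : T -> R).
Hypotheses (p1 : 1 < p) (mu_u : measurable_fun D u).

Let p0 : 0 < p. Proof. exact: lt_trans ltr01 p1. Qed.

Let pm0 : 0 < p - 1. Proof. by rewrite subr_gt0. Qed.

(** The dual weight. It is real-valued everywhere; where [u <= 0] its value is only a convention of
    [powR]. *)
Let v x := u x `^ (1 / (1 - p)).

Let mv : measurable_fun D (fun x => (v x)%:E).
Proof.
by apply/measurable_EFinP; apply: (measurableT_comp (measurable_powR _)).
Qed.

(** * From the inequality to the conditions on the weight *)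

Section necessity.
Import HBNNSimple.
Hypothesis sigma_finite_mu : sigma_finite setT mu.
Variable e : E.
Hypothesis e1 : `|e| = 1.
Hypothesis ineq : forall f : T -> E, bochner_integrable mu D f ->
  integral_well_defined mu D (fun x => (u x * `|f x| `^ p)%:E) /\
  ((`|bochner_integral mu D f| `^ p)%:E
     <= \int[mu]_(x in D) (u x * `|f x| `^ p)%:E)%E.

(** The hypothesis is tested on [h] times [e]. The majorant [g] will be 0 when proving positivity of
    [u], and [h] itself when bounding the integral of [v]. *)
Lemma scalar_inequality (h g : T -> R) : (forall x, 0 <= h x) ->
  finite_set (h @` D) -> (forall r, measurable (D `&` h @^-1` [set r])) ->
  (forall r, r != 0 -> (mu (D `&` h @^-1` [set r]) < +oo)%E) ->
  measurable_fun D g -> (forall x, D x -> 0 <= g x) ->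
  (forall x, D x -> u x * h x `^ p <= g x) ->
  exists c, [/\ 0 <= c, (\int[mu]_(x in D) (h x)%:E = c%:E)%E &
    ((c `^ p)%:E <= \int[mu]_(x in D) (g x)%:E)%E].
Proof.
move=> h0 finh mh muh mg g0 hg.
have [[mf _] le] := ineq (bochner_integrableZ e finh mh muh).
exists `|bochner_integral mu D (fun x => h x *: e)|; split => //.
  by rewrite (norm_bochner_integralZ mD e1).
apply: le_trans le _; apply: le_integral_ge0 => //; first exact/measurable_EFinP.
by move=> x Dx; rewrite lee_fin normrZ e1 mulr1 ger0_norm// hg.
Qed.

Lemma weight_gt0_ae : {ae mu, forall x, D x -> 0 < u x}.
Proof.
have [F FT mF] := sigma_finite_mu.
pose A := D `&` [set x | u x <= 0].
have mA : measurable A.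
  have -> : A = D `&` u @^-1` `]-oo, 0].
    by apply/seteqP; split=> x; rewrite /A /= in_itv.
  exact: mu_u.
have A0 k : mu (A `&` F k) = 0.
  have [mFk muFk] := mF k.
  have mAk : measurable (A `&` F k) by exact: measurableI.
  have muAk : (mu (A `&` F k) < +oo)%E.
    by apply: le_lt_trans muFk; rewrite le_measure ?inE.
  have mfiber r : measurable (D `&` \1_(A `&` F k) @^-1` [set (r : R)]).
    exact: (@measurable_indic _ _ R D _ mAk).
  (* The majorant 0 is admissible: [u <= 0] where the indicator is 1, and elsewhere its [p]-th power
     is 0. *)
  have [|||r r0|||x Dx|] := @scalar_inequality \1_(A `&` F k) (cst 0).
  - by move=> x; rewrite indicE.
  - apply: sub_finite_set (finite_set2 0 1) => _ [x _ <-].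
    by rewrite indicE; case: (x \in _); [right|left].
  - exact: mfiber.
  - apply: le_lt_trans muAk; rewrite le_measure ?inE//.
    move=> x [_ hx]; apply: contrapT => nAx; move: r0.
    by rewrite -[r]hx indicE memNset// eqxx.
  - by [].
  - by [].
  - rewrite indicE; have [/set_mem[[_ /= ux] _]|_] := boolP (x \in _).
      by rewrite powR1 mulr1.
    by rewrite powR0 ?mulr0// gt_eqF.
  move=> c [c0]; rewrite integral_indic// integral0 lee_fin => muc cp.
  have -> : mu (A `&` F k) = c%:E.
    by rewrite -muc (@setIidl _ (A `&` F k) D)// => x [[]].
  have : c `^ p = 0 by apply/eqP; rewrite eq_le cp powR_ge0.
  by move/powR_eq0_eq0 => ->.
have : mu.-negligible A.
  rewrite -(setIT A) FT setI_bigcupr; apply: negligible_bigcup => k.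
  by exists (A `&` F k); split => //; apply: measurableI => //; have [] := mF k.
apply: negligibleS => x /= /not_implyP[Dx /negP]; rewrite -leNgt => ux.
by split.
Qed.

Lemma integral_dual_weight_le1 : (\int[mu]_(x in D) (v x)%:E <= 1)%E.
Proof.
(* Increasing sets [F k] of finite measure allow monotone convergence, which reduces the claim to
   the sets [D] intersected with [F k]. *)
have /sigma_finiteP[F [FT ndF mF]] := sigma_finite_mu.
have mDF k : measurable (D `&` F k) by apply: measurableI => //; have [] := mF k.
have -> : D = \bigcup_k (D `&` F k) by rewrite -setI_bigcupr -FT setIT.
apply: (@cvge_to_le _ \oo _ _ (fun k => \int[mu]_(x in D `&` F k) (v x)%:E)%E).
  apply: ge0_nondecreasing_set_cvg_integral => //.
  - by move=> j k /ndF/subsetPset jk; apply/subsetPset; exact: setIS.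
  - by move=> k; apply: measurable_funS mv.
  - by move=> k x _; rewrite lee_fin powR_ge0.
apply: nearW => k; rewrite integral_mkcond ge0_integralTE; last first.
  by move=> x; rewrite patchE; case: ifP => // _; rewrite lee_fin powR_ge0.
apply: ge_ereal_sup => _ [h /= hv <-].
(* A simple function below the restricted weight vanishes outside a set of finite measure, so its
   nonzero fibres have finite measure and it may serve as a test function. *)
have h0out x : ~ (D `&` F k) x -> h x = 0.
  move=> nDFx; apply/eqP; rewrite eq_le fun_ge0 andbT -lee_fin.
  by apply: le_trans (hv x) _; rewrite patchE memNset.
have hin x : h x <= v x.
  have [DFx|/h0out ->] := pselect ((D `&` F k) x); last exact: powR_ge0.
  by rewrite -lee_fin; apply: le_trans (hv x) _; rewrite patchE mem_set.
rewrite -integralT_nnsfun.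
have -> : (\int[mu]_x (h x)%:E = \int[mu]_(x in D) (h x)%:E)%E.
  rewrite [RHS]integral_mkcond; apply: eq_integral => x _; rewrite patchE.
  by case: ifPn => //; rewrite notin_setE => nDx; rewrite h0out// => -[].
have [x|||r r0||x _|x _|c [c0 ->]] := @scalar_inequality h h.
- exact: fun_ge0.
- exact: sub_finite_set (image_subset h (@subsetT _ D)) (fimfunP h).
- by move=> r; apply: measurableI => //; exact: measurable_funPTI.
- apply: (@le_lt_trans _ _ (mu (F k))); last by have [] := mF k.
  rewrite le_measure ?inE//.
  + by have [] := mF k.
  + move=> x [Dx hx]; apply: contrapT => nFx; move: r0.
    by rewrite -[r]hx h0out ?eqxx// => -[].
- exact: measurable_funP.
- exact: fun_ge0.
- apply: powR_dual_le => //; exact: hin.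
(* If [c > 1], then [c^(p-1) > 1], which contradicts [c^p <= c]. *)
rewrite !lee_fin => cp; rewrite leNgt; apply/negP => c1.
move: cp; rewrite -mulr_powRB1//.
rewrite ger_pMr ?(lt_trans ltr01 c1)// leNgt => /negP; apply.
by have := gt0_ltr_powR pm0 ler01 c0 c1; rewrite powR1.
Qed.

End necessity.

(** * From the conditions on the weight to the inequality *)

Section sufficiency.
Hypothesis cmu : measure_is_complete mu.
Hypothesis u_gt0 : {ae mu, forall x, D x -> 0 < u x}.
Hypothesis v_le1 : (\int[mu]_(x in D) (v x)%:E <= 1)%E.
Variable f : T -> E.
Hypothesis mf : strongly_measurable mu D f.

Let g x := (u x * `|f x| `^ p)%:E.

Let mnf : measurable_fun D (fun x => `|f x|).
Proof. by have := strongly_measurable_norm cmu mf. Qed.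

Let mg : measurable_fun D g.
Proof.
apply/measurable_EFinP; apply: measurable_funM => //.
exact: (measurableT_comp (measurable_powR _)).
Qed.

(** Positivity of [u] holds only almost everywhere, so [g] may be negative on a null set; this
    justifies replacing [g] by its positive part. *)
Let integral_funeneg : (\int[mu]_(x in D) g^\- x = 0)%E.
Proof.
rewrite -(integral0 mu D); apply: ge0_ae_eq_integral => //.
  exact: measurable_funeneg.
apply: filterS u_gt0 => x ux Dx; rewrite funenegE; apply/max_idPr.
by rewrite leeNl oppe0 lee_fin mulr_ge0 ?powR_ge0// ltW// ux.
Qed.

Lemma weighted_integral_well_defined : integral_well_defined mu D g.
Proof. by split => //; rewrite integral_funeneg oppe0 fin_num_adde_defl. Qed.

Lemma norm_bochner_integral_powR_le :
  ((`|bochner_integral mu D f| `^ p)%:E <= \int[mu]_(x in D) g x)%E.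
Proof.
have := norm_bochner_integral_le mD cmu mf.
set c := `|_| => normB; have c0 : 0 <= c by exact: normr_ge0.
rewrite integralE integral_funeneg sube0.
have mgp : measurable_fun D g^\+%E by exact: measurable_funepos.
set G := (\int[mu]_(x in D) _)%E.
have mcv : measurable_fun D (fun x => ((p - 1) * c `^ p)%:E * (v x)%:E)%E.
  exact: measurable_funeM.
(* Young's inequality is integrated with [g^\+] in place of [g], so that both integrands are
   nonnegative everywhere, while the comparison holds where [u > 0]. *)
have young : (\int[mu]_(x in D) ((p * c `^ (p - 1))%:E * (`|f x|)%:E)
    <= \int[mu]_(x in D) (g^\+ x + ((p - 1) * c `^ p)%:E * (v x)%:E))%E.
  apply: ae_ge0_le_integral => //.
  - by move=> x _; rewrite lee_fin !mulr_ge0 ?powR_ge0// ltW.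
  - by apply: measurable_funeM; exact/measurable_EFinP.
  - by move=> x _; rewrite adde_ge0// lee_fin !mulr_ge0 ?powR_ge0// ltW.
  - exact: emeasurable_funD.
  apply: filterS u_gt0 => x /[apply] ux.
  apply: (@le_trans _ _ (g x + ((p - 1) * c `^ p)%:E * (v x)%:E)%E).
    by rewrite -EFinD lee_fin young_powR.
  by rewrite leeD2r// funeposE le_max lexx.
rewrite ge0_integralZl_EFin// in young; last 2 first.
- exact/measurable_EFinP.
- by rewrite mulr_ge0 ?powR_ge0// ltW.
rewrite ge0_integralD// in young; last first.
  by move=> x _; rewrite lee_fin !mulr_ge0 ?powR_ge0// ltW.
rewrite ge0_integralZl_EFin// in young; last 2 first.
- by move=> x _; rewrite lee_fin powR_ge0.
- by rewrite mulr_ge0 ?powR_ge0// ltW.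
(* The integral of [|f|] is bounded below by [c], and that of [v] above by 1. *)
have : ((p * c `^ (p - 1))%:E * c%:E <= G + ((p - 1) * c `^ p)%:E * 1)%E.
  apply: (@le_trans _ _ ((p * c `^ (p - 1))%:E * \int[mu]_(x in D) (`|f x|)%:E)%E).
    apply: lee_pmul => //; rewrite ?lee_fin ?mulr_ge0 ?powR_ge0 ?(ltW p0)//.
  apply: le_trans young _; apply: leeD => //; apply: lee_pmul => //.
  - by rewrite lee_fin mulr_ge0 ?powR_ge0// ltW.
  - by apply: integral_ge0 => x _; rewrite lee_fin powR_ge0.
have := mulr_powRB1 c0 p0.
(* For finite [G], the identity [c c^(p-1) = c^p] makes the left side [p c^p]; subtracting the
   finite term [(p-1) c^p] leaves [c^p <= G]. *)
rewrite mule1; case: G => [r| |] /=; rewrite ?addNye ?leey//.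
by move=> cp; rewrite -EFinM -EFinD !lee_fin -mulrA [_ * c]mulrC cp; lra.
Qed.

End sufficiency.
End weighted_inequality.

Theorem theorem2p3 (R : realType) (n : nat) (p : R) (hp : 1 < p)
  (Omega : set (Rn R n)) (hOmega : measurable Omega)
  (E : completeNormedModType R) (hE : exists e : E, e != 0)
  (u : Rn R n -> R) (hu : measurable_fun Omega u) :
  let mu := lebesgue_Rn R n in
  (forall f : Rn R n -> E, bochner_integrable mu Omega f ->
     integral_well_defined mu Omega (fun x => (u x * `|f x| `^ p)%:E) /\
     ((`|bochner_integral mu Omega f| `^ p)%:E
        <= \int[mu]_(x in Omega) (u x * `|f x| `^ p)%:E)%E)
  <->
  ({ae mu, forall x, Omega x -> 0 < u x} /\
   (\int[mu]_(x in Omega) (u x `^ (1 / (1 - p)))%:E <= 1)%E).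
Proof.
move=> mu; split=> [ineq|[u_gt0 v_le1] f [mf _]].
  have [e0 e0_neq0] := hE.
  pose e := `|e0|^-1 *: e0.
  have e1 : `|e| = 1 by rewrite normrZ normfV normr_id mulVf// normr_eq0.
  have sf := @lebesgue_Rn_sigma_finite R n.
  split; first exact: weight_gt0_ae e1 ineq.
  exact: integral_dual_weight_le1 e1 ineq.
have cmu := @lebesgue_Rn_complete R n.
split; first exact: weighted_integral_well_defined.
exact: norm_bochner_integral_powR_le.
Qed.
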